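(* Assume that $\det\gamma_j\ne 0$ for all $j\geqslant 1$, where the matrices $\alpha_j,\beta_j,\gamma_j\in\mathbb{R}^{n\times n}$ are defined recursively by $$\alpha_{j+1}=\gamma_j\beta_j,\qquad \beta_{j+1}=\gamma_j^{-1}\alpha_j\gamma_{j-1}\gamma_j^{-1},\qquad \gamma_j=\mathcal{L}_A(\alpha_j\gamma_{j-1}),\qquad j\geqslant 1,$$ with initial conditions $\alpha_1=\gamma_0=\Theta$ and $\beta_1=\Theta^{-1}\mho\Theta^{-1}$. Then the transfer functions $E(s)=(sI_n-A)^{-1}$ and $E^\sim(s)=-(sI_n+A^{\mathrm T})^{-1}$ satisfy, for every integer $k\geqslant 1$ (as an identity between rational matrix-valued functions of $s\in\mathbb{C}$), $$(E\mho E^\sim)^k=(-1)^k\,\big(\alpha_1^{\mathrm T}E^\sim\,\alpha_2^{\mathrm T}E^\sim\cdots\alpha_k^{\mathrm T}E^\sim\big)\,\beta_k\,\big(E\alpha_k\,E\alpha_{k-1}\cdots E\alpha_1\big).$$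
   Context: Setting: $n,m$ are even positive integers; $\Theta\in\mathbb{R}^{n\times n}$ is a nonsingular antisymmetric matrix; $R=R^{\mathrm T}\in\mathbb{R}^{n\times n}$; $M\in\mathbb{R}^{m\times n}$; $J:=\begin{bmatrix}0&I_{m/2}\\-I_{m/2}&0\end{bmatrix}$; $A:=2\Theta(R+M^{\mathrm T}JM)$, $B:=2\Theta M^{\mathrm T}$, and $\mho:=BJB^{\mathrm T}=-\mho^{\mathrm T}$. These satisfy $A\Theta+\Theta A^{\mathrm T}+\mho=0$. The matrix $A$ is assumed to be Hurwitz (all eigenvalues have negative real part). The linear operator $\mathcal{L}_A$ is $\mathcal{L}_A(V):=\int_0^{\infty}\mathrm{e}^{tA}V\mathrm{e}^{tA^{\mathrm T}}\,\mathrm{d}t$ for $V\in\mathbb{C}^{n\times n}$, so that $X=\mathcal{L}_A(V)$ is the unique solution of $AX+XA^{\mathrm T}+V=0$; in particular $\mathcal{L}_A(\mho)=\Theta$. *)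

(* Defs.v *)
From HB Require Import structures.
From mathcomp Require Export all_boot all_order all_algebra.
From mathcomp Require Export all_classical all_reals all_analysis.
From mathcomp Require Export complex.

Set Implicit Arguments.
Unset Strict Implicit.
Unset Printing Implicit Defensive.

Export Order.TTheory GRing.Theory Num.Theory numFieldNormedType.Exports.
#[global] Open Scope classical_set_scope.
#[global] Open Scope ring_scope.

(* The even number of field channels is written m = h + h, so that J is
   literally a 2 x 2 block matrix with blocks of order h = m / 2. *)
Definition symplJ (K : realType) (h : nat) : 'M[K]_(h + h) :=
  block_mx 0 1%:M (- 1%:M) 0.

Definition drift_mx (K : realType) (n h : nat) (Theta R : 'M[K]_n)
    (M : 'M[K]_(h + h, n)) : 'M[K]_n :=
  2%:R *: (Theta *m (R + M^T *m symplJ K h *m M)).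

Definition gain_mx (K : realType) (n h : nat) (Theta : 'M[K]_n)
    (M : 'M[K]_(h + h, n)) : 'M[K]_(n, h + h) :=
  2%:R *: (Theta *m M^T).

Definition mho_mx (K : realType) (n h : nat) (Theta : 'M[K]_n)
    (M : 'M[K]_(h + h, n)) : 'M[K]_n :=
  gain_mx Theta M *m symplJ K h *m (gain_mx Theta M)^T.

Definition complex_mx (K : realType) (m n : nat) (A : 'M[K]_(m, n)) :
    'M[K[i]]_(m, n) :=
  map_mx (real_complex K) A.

(* Re is the K-valued real part; eigenvalues range over the complex numbers. *)
Definition Hurwitz (K : realType) (n : nat) (A : 'M[K]_n) : Prop :=
  forall lambda : K[i], eigenvalue (complex_mx A) lambda ->
    complex.Re lambda < 0.

(* The power is the one of the ring of square matrices, available for every n;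
   the limit is taken in the normed module of matrices. *)
Definition expmx (K : realType) (n : nat) (A : 'M[K]_n) : 'M[K]_n :=
  limn (series (fun k : nat => (k`!%:R : K)^-1 *: (A ^+ k : 'M[K]_n))).

(* The operator V |-> int_0^oo exp(tA) V exp(tA^T) dt on real matrices, as an
   entrywise Lebesgue integral. Rintegral is total: the value is meaningful
   when the integrand is integrable, in particular when A is Hurwitz. *)
Definition lyap_op (K : realType) (n : nat) (A V : 'M[K]_n) : 'M[K]_n :=
  \matrix_(i < n, j < n)
    Rintegral (@lebesgue_measure K) `[0, +oo[
      (fun t : K => (expmx (t *: A) *m V *m expmx (t *: A^T)) i j).

(* invmx is total (the identity on singular matrices): these are the values of
   the rational functions E and E~ only at s which are not poles, i.e. where
   the matrix under invmx is in unitmx. *)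
Definition tfE (K : realType) (n : nat) (A : 'M[K]_n) (s : K[i]) :
    'M[K[i]]_n :=
  invmx (s%:M - complex_mx A).

Definition tfEadj (K : realType) (n : nat) (A : 'M[K]_n) (s : K[i]) :
    'M[K[i]]_n :=
  - invmx (s%:M + complex_mx A^T).

(* Main.v *)
(* A matrix V = P g - g N with g invertible satisfies
   P^-1 V N^-1 = g N^-1 (g^-1 V g^-1) P^-1 g, which exchanges P^-1 and N^-1.
   With P = E^-1 = s - A and N = - E~^-1 = s + A^T the hypothesis is the
   Lyapunov equation
   A g + g A^T + V = 0, so that it holds for (g, V) = (Theta, mho) and for
   (gamma_j, alpha_j gamma_(j-1)).  Hence multiplying E alpha_k ... E alpha_1
   on the right by E mho E~ moves the new factor E~ leftwards through the whole
   cascade and produces gamma_k E~ beta_(k+1) E alpha_(k+1) ... E alpha_1.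
   Since beta_k and gamma_k have opposite symmetry types,
   beta_k gamma_k = - alpha_(k+1)^T, and induction on k concludes.

   The Lyapunov equation for the integral L_A(V) comes from integrating
   d/dt (e^(tA) V e^(tA^T)), once e^(tA) is known to decay exponentially.  The
   decay is obtained without any normal form: by Cayley-Hamilton
   prod_i (A - z_i) = 0, and each factor is peeled off by a scalar linear ODE
   y' = z_i y + u, with Re z_i < 0 and u decaying. *)
Require Import Defs.
From mathcomp Require Import ring lra measurable_realfun.

Set Implicit Arguments.
Unset Strict Implicit.
Unset Printing Implicit Defensive.

(** * The matrix exponential as a family of scalar power series *)

Lemma cvg_mx_entries (K : realType) (m n : nat) (F : set_system 'M[K]_(m, n))
    (FF : Filter F) (L : 'M[K]_(m, n)) :
  (forall i j, (fun N : 'M[K]_(m, n) => N i j) @ F --> L i j) -> F --> L.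
Proof.
move=> FL; apply/cvg_mx_entourageP => S entS.
apply: (@filter_forall _ _
  (fun i => [set N : 'M[K]_(m, n) | forall j, (L i j, N i j) \in S]) F FF).
move=> i; apply: (@filter_forall _ _
  (fun j => [set N : 'M[K]_(m, n) | (L i j, N i j) \in S]) F FF).
move=> j; have /cvg_app_entourageP/(_ S entS) := FL i j.
by apply: filterS => N; rewrite /= inE.
Qed.

Lemma cvgn_fsum (K : realType) (I : finType) (u : I -> K^nat) (l : I -> K) :
  (forall i, u i @ \oo --> l i) ->
  (fun k => \sum_i u i k) @ \oo --> \sum_i l i.
Proof.
by move=> ul; apply: cvg_big => //; exact: add_continuous.
Qed.

Lemma sum_normr_entries_ge0 (K : numDomainType) (m n : nat) (A : 'M[K]_(m, n)) :
  0 <= \sum_a \sum_b `|A a b|.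
Proof. by rewrite sumr_ge0// => a _; rewrite sumr_ge0. Qed.

(** The sum of the absolute values of the entries is submultiplicative; this crude bound is enough
    to dominate the exponential series by a scalar one. *)
Lemma normr_exprmx_le (K : realType) (n : nat) (A B : 'M[K]_n) (k : nat) i j :
  `|(A ^+ k *m B) i j| <=
  (\sum_a \sum_b `|A a b|) ^+ k * (\sum_a \sum_b `|B a b|).
Proof.
have le1 (C : 'M[K]_n) a b : `|C a b| <= \sum_a \sum_b `|C a b|.
  rewrite (bigD1 a)//= (bigD1 b)//= -addrA lerDl addr_ge0//.
    by rewrite sumr_ge0.
  by rewrite sumr_ge0// => ? _; rewrite sumr_ge0.
elim: k i => [|k IH] i; first by rewrite expr0 mul1mx mul1r le1.
rewrite exprS -mulmxE -mulmxA mxE (le_trans (ler_norm_sum _ _ _))//.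
under eq_bigr do rewrite normrM.
have -> : (\sum_a \sum_b `|A a b|) ^+ k.+1 * (\sum_a \sum_b `|B a b|) =
  (\sum_a \sum_b `|A a b|) *
    ((\sum_a \sum_b `|A a b|) ^+ k * (\sum_a \sum_b `|B a b|)).
  by rewrite exprS mulrA.
apply: (@le_trans _ _ (\sum_l `|A i l| *
  ((\sum_a \sum_b `|A a b|) ^+ k * (\sum_a \sum_b `|B a b|)))).
  by apply: ler_sum => l _; rewrite ler_wpM2l.
rewrite -mulr_suml ler_wpM2r//.
  by rewrite mulr_ge0// ?exprn_ge0// sum_normr_entries_ge0.
rewrite [leRHS](bigD1 i)//= lerDl.
by rewrite sumr_ge0// => ? _; rewrite sumr_ge0.
Qed.

Lemma exprmxZ (K : comPzRingType) (n : nat) (a : K) (A : 'M[K]_n) (k : nat) :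
  (a *: A) ^+ k = a ^+ k *: A ^+ k.
Proof.
elim: k => [|k IH]; first by rewrite !expr0 scale1r.
by rewrite !exprS IH -!mulmxE -scalemxAl -scalemxAr scalerA.
Qed.

(** The factor [B] makes the family closed under differentiation, which replaces [B] by [A *m B]. *)
Definition expmx_coef (K : realType) (n : nat) (A B : 'M[K]_n) (i j : 'I_n) :
    K^nat :=
  fun k => (k`!%:R)^-1 * (A ^+ k *m B) i j.

Lemma is_cvg_expmx_coef (K : realType) (n : nat) (A B : 'M[K]_n) i j (x : K) :
  cvgn (pseries (expmx_coef A B i j) x).
Proof.
rewrite /pseries; apply: normed_cvg.
set a := \sum_a \sum_b `|A a b|; set b := \sum_a \sum_b `|B a b|.
apply: (@series_le_cvg _ _ (fun k => b * exp_coeff (a * `|x|) k)).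
- by move=> k /=; apply: normr_ge0.
- move=> k; rewrite /exp_coeff /= mulr_ge0//.
    exact: sum_normr_entries_ge0.
  rewrite divr_ge0// exprn_ge0// mulr_ge0//.
  exact: sum_normr_entries_ge0.
- move=> k; rewrite /expmx_coef /exp_coeff /= !normrM normfV normr_nat normrX.
  rewrite [leRHS]mulrC exprMn -!mulrA mulrC -!mulrA.
  rewrite [leRHS](_ : _ = (k`!%:R)^-1 * `|x| ^+ k * (a ^+ k * b)); last by ring.
  rewrite [leLHS](_ : _ = (k`!%:R)^-1 * `|x| ^+ k * `|(A ^+ k *m B) i j|);
    last by ring.
  by rewrite ler_wpM2l// ?normr_exprmx_le// mulr_ge0// ?invr_ge0// exprn_ge0.
- rewrite (_ : (fun k => _) = b *: exp_coeff (a * `|x|)); last exact/funext.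
  by rewrite /=; apply: is_cvg_seriesZ; apply: is_cvg_series_exp_coeff.
Qed.

Lemma expmx_coef_diffs (K : realType) (n : nat) (A B : 'M[K]_n) i j :
  pseries_diffs (expmx_coef A B i j) = expmx_coef A (A *m B) i j.
Proof.
apply/funext => k; rewrite /pseries_diffs /expmx_coef mulrA factS natrM invfM.
by rewrite mulVKf ?pnatr_eq0// exprSr -mulmxE -mulmxA.
Qed.

Lemma expmxE (K : realType) (n : nat) (A B : 'M[K]_n) (t : K) i j :
  (expmx (t *: A) *m B) i j = limn (pseries (expmx_coef A B i j) t).
Proof.
have cv1 (a b : 'I_n) : cvgn (pseries (expmx_coef A 1%:M a b) t).
  exact: is_cvg_expmx_coef.
(* The limit is identified entrywise for [B = 1%:M] first; a general [B] only adds a finite linear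
   combination of such limits. *)
pose L : 'M[K]_n := \matrix_(a, b) limn (pseries (expmx_coef A 1%:M a b) t).
have entE k (a b : 'I_n) :
  series (fun k : nat => (k`!%:R : K)^-1 *: ((t *: A) ^+ k : 'M[K]_n)) k a b =
  pseries (expmx_coef A 1%:M a b) t k.
  rewrite /pseries /series /= summxE; apply: eq_bigr => l _.
  by rewrite exprmxZ !mxE /expmx_coef mulmx1; ring.
have -> : expmx (t *: A) = L.
  apply: cvg_lim => //; apply: cvg_mx_entries => a b.
  have := cv1 a b; rewrite mxE (_ : pseries _ t =
    (fun N : 'M[K]_n => N a b) \o
      series (fun k : nat => (k`!%:R : K)^-1 *: ((t *: A) ^+ k : 'M[K]_n))).
    exact.
  by apply/funext => k; rewrite /= -entE.
apply/esym/cvg_lim => //.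
rewrite mxE
  (_ : pseries _ t =
    fun k => \sum_l pseries (expmx_coef A 1%:M i l) t k * B l j).
  rewrite /=; apply: cvgn_fsum => l.
  by rewrite !mxE; apply: cvgMr_tmp; exact: cv1.
apply/funext => k; rewrite /pseries /series /=.
under [RHS]eq_bigr do rewrite mulr_suml.
rewrite exchange_big/=; apply: eq_bigr => l _.
rewrite /expmx_coef mxE mulr_sumr mulr_suml; apply: eq_bigr => m _.
by rewrite mulmx1; ring.
Qed.

Lemma is_derive_expmxM (K : realType) (n : nat) (A B : 'M[K]_n) (t : K) i j :
  is_derive t 1 (fun t => (expmx (t *: A) *m B) i j)
    ((expmx (t *: A) *m (A *m B)) i j).
Proof.
rewrite (_ : (fun t => _) = fun t => limn (pseries (expmx_coef A B i j) t)).
  rewrite expmxE -expmx_coef_diffs.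
  (* Termwise differentiation at [t] needs convergence at a point of larger modulus; as the series
     converges everywhere, any such point will do. *)
  apply: (@pseries_snd_diffs _ _ (`|t| + 1)); rewrite ?expmx_coef_diffs;
    try exact: is_cvg_expmx_coef.
  by rewrite [ltRHS]ger0_norm ?addr_ge0// ltrDl.
by apply/funext => u; rewrite expmxE.
Qed.

Lemma expmx_tr (K : realType) (n : nat) (A : 'M[K]_n) (t : K) :
  expmx (t *: A^T) = (expmx (t *: A))^T.
Proof.
apply/matrixP => i j;
  rewrite mxE -[expmx _ in LHS]mulmx1 -[expmx _ in RHS]mulmx1.
rewrite !expmxE; congr (limn (pseries _ t)); apply/funext => k.
rewrite /expmx_coef !mulmx1; congr (_ * _).
suff -> : A^T ^+ k = (A ^+ k)^T by rewrite mxE.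
elim: k => [|k IH]; first by rewrite !expr0 trmx1.
by rewrite exprS exprSr IH -!mulmxE trmx_mul.
Qed.

Lemma expmx_comm (K : realType) (n : nat) (A : 'M[K]_n) (t : K) :
  expmx (t *: A) *m A = A *m expmx (t *: A).
Proof.
apply/matrixP => i j; rewrite expmxE; apply: cvg_lim => //.
rewrite mxE
  (_ : pseries _ t =
    fun k => \sum_l A i l * pseries (expmx_coef A 1%:M l j) t k).
  apply: cvgn_fsum => l; apply: cvgMl_tmp.
  by rewrite -[expmx _ in X in _ --> X]mulmx1 expmxE; exact: is_cvg_expmx_coef.
apply/funext => k; rewrite /pseries /series /=.
under [RHS]eq_bigr do rewrite mulr_sumr.
rewrite exchange_big/=; apply: eq_bigr => l _.
rewrite /expmx_coef mulmxE -exprSr exprS -mulmxE mxE mulr_sumr mulr_suml.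
by apply: eq_bigr => m _; rewrite mulmx1; ring.
Qed.

Lemma expmx0 (K : realType) (n : nat) (A : 'M[K]_n) : expmx (0 *: A) = 1%:M.
Proof.
apply/matrixP => i j; rewrite -[expmx _]mulmx1 expmxE.
(* The partial sum of index 0 is empty; all later ones equal the constant term. *)
apply: cvg_lim => //; rewrite -cvg_shiftS/=.
rewrite (_ : (fun k => _) = cst (1%:M i j)); first exact: cvg_cst.
apply/funext => k; rewrite /pseries /series /= big_nat_recl//= big1.
  by rewrite addr0 /expmx_coef expr0 mulmx1 fact0 invr1 mul1r mulr1.
by move=> l _; rewrite expr0n/= mulr0.
Qed.

(** * Exponentially decaying functions on the half-line *)

(** The rate is existential because it may shrink each time a linear differential equation is
    solved. *)
Definition expdecay (K : realType) (f : K -> K) : Prop :=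
  exists C mu : K, [/\ 0 <= C, 0 < mu &
    forall t, 0 <= t -> `|f t| <= C * expR (- (mu * t))].

Lemma expdecay_pair (K : realType) (f g : K -> K) :
  expdecay f -> expdecay g ->
  exists C mu : K, [/\ 0 <= C, 0 < mu &
    forall t, 0 <= t -> `|f t| <= C * expR (- (mu * t)) /\
                        `|g t| <= C * expR (- (mu * t))].
Proof.
move=> [C [mu [C0 mu0 fC]]] [D [nu [D0 nu0 gD]]].
exists (C + D), (Num.min mu nu); split.
- exact: addr_ge0.
- by rewrite lt_min mu0.
- move=> t t0; split.
    rewrite (le_trans (fC t t0))// ler_pM ?expR_ge0//; first by rewrite lerDl.
    by rewrite ler_expR lerN2 ler_wpM2r// ge_min lexx.
  rewrite (le_trans (gD t t0))// ler_pM ?expR_ge0//; first by rewrite lerDr.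
  by rewrite ler_expR lerN2 ler_wpM2r// ge_min lexx orbT.
Qed.

Lemma expdecay0 (K : realType) : expdecay (fun _ : K => 0).
Proof. by exists 0, 1; split=> // t _; rewrite normr0 mul0r. Qed.

Lemma expdecayD (K : realType) (f g : K -> K) :
  expdecay f -> expdecay g -> expdecay (fun t => f t + g t).
Proof.
move=> df dg; have [C [mu [C0 mu0 fgC]]] := expdecay_pair df dg.
exists (C + C), mu; split=> //; first exact: addr_ge0.
move=> t /fgC[fC gC]; rewrite mulrDl (le_trans (ler_normD _ _))//.
exact: lerD.
Qed.

Lemma expdecayM (K : realType) (f g : K -> K) :
  expdecay f -> expdecay g -> expdecay (fun t => f t * g t).
Proof.
move=> df dg; have [C [mu [C0 mu0 fgC]]] := expdecay_pair df dg.
exists (C * C), mu; split=> //; first exact: mulr_ge0.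
move=> t t0; have [fC gC] := fgC t t0.
rewrite normrM (le_trans (ler_pM _ _ fC gC))//.
rewrite mulrACA ler_wpM2l ?mulr_ge0// ler_piMr ?expR_ge0//.
by rewrite expR_le1 oppr_le0 mulr_ge0// ltW.
Qed.

Lemma expdecayZ (K : realType) (a : K) (f : K -> K) :
  expdecay f -> expdecay (fun t => a * f t).
Proof.
move=> [C [mu [C0 mu0 fC]]]; exists (`|a| * C), mu; split=> //.
  exact: mulr_ge0.
by move=> t t0; rewrite normrM -mulrA ler_wpM2l// fC.
Qed.

Lemma expdecay_sum (K : realType) (I : Type) (r : seq I) (f : I -> K -> K) :
  (forall i, expdecay (f i)) -> expdecay (fun t => \sum_(i <- r) f i t).
Proof.
move=> df; elim: r => [|i r IH].
  by under eq_fun do rewrite big_nil; exact: expdecay0.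
by under eq_fun do rewrite big_cons; exact: expdecayD.
Qed.

(** * Scalar linear differential equations and decay of the exponential of a Hurwitz matrix *)

Lemma is_derive_continuous (K : realType) (f df : K -> K) :
  (forall t, is_derive t (1 : K) f (df t)) -> continuous f.
Proof.
move=> dfx t; apply/differentiable_continuous/derivable1_diffP.
by case: (dfx t).
Qed.

Lemma is_derive_expRM (K : realType) (a t : K) :
  is_derive t 1 (fun x => expR (a * x)) (a * expR (a * t)).
Proof.
have da : is_derive t 1 (fun x : K => a * x) a.
  have := is_deriveZ a (is_derive_id t (1 : K)).
  by rewrite /GRing.scale /= mulr1.
have := is_derive1_comp (is_derive_expR (a * t)) da.
by rewrite mulrC.
Qed.

(* [p] and [q] are the real and imaginary parts of a solution of
   [y' = (a + i b) y + (u + i v)]. *)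
Lemma expdecay_ode (K : realType) (a b : K) (p q u v : K -> K) :
  a < 0 ->
  (forall t, is_derive t (1 : K) p (a * p t - b * q t + u t)) ->
  (forall t, is_derive t (1 : K) q (a * q t + b * p t + v t)) ->
  expdecay u -> expdecay v -> expdecay p /\ expdecay q.
Proof.
move=> a0 dp dq du dv; have [C [mu [C0 mu0 uvC]]] := expdecay_pair du dv.
(* The bound [2 * nu <= - a] lets the damping absorb both the weight and the Young terms;
   [2 * nu <= mu] makes the weighted forcing, of order [exp((2 nu - 2 mu) t)], at most of order
   [exp(- mu t)]. *)
pose nu := Num.min (- a / 2) (mu / 2).
have nu0 : 0 < nu by rewrite /nu lt_min; apply/andP; split; lra.
have nua : 2 * nu <= - a.
  have : nu <= - a / 2 by rewrite /nu ge_min lexx.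
  lra.
have numu : 2 * nu <= mu.
  have : nu <= mu / 2 by rewrite /nu ge_min lexx orbT.
  lra.
(* By Young's inequality [u] and [v] each contribute at most [C ^+ 2 / - a], up to the squared
   exponential. *)
pose D := 2 * C ^+ 2 / - a.
have D0 : 0 <= D by rewrite divr_ge0 ?mulr_ge0 ?sqr_ge0//; lra.
(* [w] is the energy [p^2 + q^2], weighted by [exp(2 nu t)] and corrected by a
   decaying term that absorbs the contribution of [u] and [v]. *)
pose w := ((p * p + q * q) * (fun t => expR (2 * nu * t))
  + (D / mu) \*: (fun t => expR (- mu * t)) : K -> K).
(* The terms in [b] have cancelled: the rotation part of the equation preserves
   [p ^+ 2 + q ^+ 2]. *)
pose w' t := expR (2 * nu * t) *
   (2 * (a + nu) * (p t ^+ 2 + q t ^+ 2) + 2 * (p t * u t + q t * v t))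
   - D * expR (- mu * t).
have dw t : is_derive t (1 : K) w (w' t).
  apply:
    (is_derive_eq (is_deriveD (is_deriveM (is_deriveD (is_deriveM (dp t) (dp t))
     (is_deriveM (dq t) (dq t))) (is_derive_expRM (2 * nu) t))
     (is_deriveZ (D / mu) (is_derive_expRM (- mu) t)))).
  rewrite /w' !fctE /GRing.scale /=.
  by field; rewrite gt_eqF.
have w'_le0 t : 0 <= t -> w' t <= 0.
  move=> t0; have [uC vC] := uvC t t0.
  have sq (x : K) : `|x| <= C * expR (- (mu * t)) ->
      x ^+ 2 <= C ^+ 2 * (expR (- (mu * t)) ^+ 2).
    by move=> xC;
      rewrite -exprMn -real_normK ?num_real// lerXn2r// nnegrE mulr_ge0//
        expR_ge0.
  have := sq _ uC; have := sq _ vC.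
  set e := expR (- (mu * t)) => v2 u2.
  have young (x y : K) : 2 * (x * y) <= - a * x ^+ 2 + y ^+ 2 / - a.
    rewrite -subr_ge0 (_ : _ - _ = (a * x + y) ^+ 2 / - a); last by field;
      rewrite ?oppr_eq0 lt_eqF.
    by rewrite divr_ge0 ?sqr_ge0//; lra.
  have key : 2 * (a + nu) * (p t ^+ 2 + q t ^+ 2) + 2 * (p t * u t + q t * v t)
      <= D * e ^+ 2.
    have h1 : 0 <= (- a - 2 * nu) * (p t ^+ 2 + q t ^+ 2).
      by rewrite mulr_ge0//; [lra | rewrite addr_ge0 ?sqr_ge0].
    have h2 : (u t ^+ 2 + v t ^+ 2) / - a <= D * e ^+ 2.
      rewrite (_ : D * _ = (C ^+ 2 * e ^+ 2 + C ^+ 2 * e ^+ 2) / - a).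
        by rewrite ler_pM2r ?invr_gt0 ?lerD//; lra.
      by rewrite /D; field; lra.
    have h3 := young (p t) (u t); have h4 := young (q t) (v t).
    rewrite mulrDl in h2; move: h1 h2 h3 h4.
    move: (u t ^+ 2 / - a) (v t ^+ 2 / - a) (D * e ^+ 2) => x y z; lra.
  rewrite /w' subr_le0 (_ : - mu * t = - (mu * t)) ?mulNr// -/e.
  apply: (@le_trans _ _ (expR (2 * nu * t) * (D * e ^+ 2))).
    by rewrite ler_pM2l ?expR_gt0.
  rewrite mulrCA ler_wpM2l// expr2 mulrA ler_piMl ?expR_ge0// /e -expRD.
  by rewrite expR_le1 subr_le0 ler_wpM2r.
have wcont : {within `[0, +oo[, continuous w}.
  by apply: continuous_subspaceT; exact: is_derive_continuous dw.
have wle t : 0 <= t -> w t <= w 0.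
  move=> t0; apply: (@ler0_derive1_nincry _ w 0) => //.
  move=> x; rewrite in_itv/= andbT => /ltW x0.
  by rewrite derive1E; have [_ ->] := dw x; exact: w'_le0.
have wE t : w t =
  (p t ^+ 2 + q t ^+ 2) * expR (2 * nu * t) + D / mu * expR (- mu * t).
  by rewrite /w !fctE /GRing.scale /= -!expr2.
(* The constant [w 0 + 1] replaces the square root of [w 0], which it dominates. *)
have bnd (x : K) t : 0 <= t -> x ^+ 2 <= p t ^+ 2 + q t ^+ 2 ->
    `|x| <= (w 0 + 1) * expR (- (nu * t)).
  move=> t0 xpq; have := wle _ t0.
  rewrite wE; set W := w 0 => wW.
  rewrite expRN ler_pdivlMr ?expR_gt0//.
  have De : 0 <= D / mu * expR (- mu * t).
    by rewrite mulr_ge0 ?expR_ge0// divr_ge0// ltW.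
  have E2 : expR (2 * nu * t) = expR (nu * t) ^+ 2.
    by rewrite expr2 -expRD; congr expR; ring.
  have xW : (`|x| * expR (nu * t)) ^+ 2 <= W.
    rewrite exprMn real_normK ?num_real// -E2.
    apply: le_trans wW;
      apply: le_trans (_ : _ <= (p t ^+ 2 + q t ^+ 2) * expR (2 * nu * t)) _.
      by rewrite ler_wpM2r// expR_ge0.
    by rewrite lerDl.
  have W0 : 0 <= W := le_trans (sqr_ge0 _) xW.
  rewrite -[leLHS]ger0_norm ?mulr_ge0 ?expR_ge0// -[leRHS]ger0_norm; last lra.
  by rewrite -ler_sqr ?nnegrE// !real_normK ?num_real//; nra.
split; exists (w 0 + 1), nu; split=> //.
- by rewrite addr_ge0// wE addr_ge0// mulr_ge0 ?expR_ge0// ?addr_ge0 ?sqr_ge0//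
    divr_ge0// ltW.
- by move=> t t0; apply: bnd => //; rewrite lerDl sqr_ge0.
- by rewrite addr_ge0// wE addr_ge0// mulr_ge0 ?expR_ge0// ?addr_ge0 ?sqr_ge0//
    divr_ge0// ltW.
- by move=> t t0; apply: bnd => //; rewrite lerDr sqr_ge0.
Qed.

(** Induction on [r] with [Q] general: if [z] is the last factor, [Q' = (A - z) Q] is annihilated by
    the others, and [y = exp(tA) Q] solves [y' = z y + exp(tA) Q']. Since [expmx] is defined on real
    matrices only, real and imaginary parts are carried separately. *)
Lemma expdecay_expmx_factors (K : realType) (n : nat) (A : 'M[K]_n)
    (r : seq K[i]) (Q : 'M[K[i]]_n) :
  (forall z, z \in r -> complex.Re z < 0) ->
  (\prod_(z <- r) (complex_mx A - z%:M)) *m Q = 0 ->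
  forall i j,
    expdecay (fun t => (expmx (t *: A) *m map_mx (@complex.Re K) Q) i j) /\
    expdecay (fun t => (expmx (t *: A) *m map_mx (@complex.Im K) Q) i j).
Proof.
elim/last_ind: r Q => [|r z IH] Q rneg.
  rewrite big_nil mul1mx => -> i j.
  have Re0 : map_mx (@complex.Re K) (0 : 'M[K[i]]_n) = 0.
    by apply/matrixP => a b; rewrite !mxE.
  have Im0 : map_mx (@complex.Im K) (0 : 'M[K[i]]_n) = 0.
    by apply/matrixP => a b; rewrite !mxE.
  rewrite Re0 Im0 (_ : (fun t => _) = fun=> 0).
    by split; exact: expdecay0.
  by apply/funext => t; rewrite mulmx0 mxE.
rewrite big_rcons/= -mulmxE -mulmxA => Q0 i j.
have [|U V] := IH _ _ Q0 i j.
  by move=> y yr; apply: rneg; rewrite mem_rcons inE yr orbT.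
set Q' := (complex_mx A - z%:M) *m Q in U V.
have z0 : complex.Re z < 0 by apply: rneg; rewrite mem_rcons mem_head.
have AQ : complex_mx A *m Q = z *: Q + Q'.
  by rewrite /Q' mulmxBl mul_scalar_mx addrC subrK.
have ReAQ : A *m map_mx (@complex.Re K) Q =
    complex.Re z *: map_mx (@complex.Re K) Q
    - complex.Im z *: map_mx (@complex.Im K) Q + map_mx (@complex.Re K) Q'.
  apply/matrixP => a b; have :=
    congr1 (fun X : 'M[K[i]]_n => complex.Re (X a b)) AQ.
  rewrite !mxE raddf_sum/= => E.
  rewrite (_ : \sum_l _ = \sum_l complex.Re (complex_mx A a l * Q l b));
    last first.
    by apply: eq_bigr => l _; rewrite !mxE; case: (Q l b) => x y /=;
      rewrite mul0r subr0.
  rewrite E.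
  rewrite raddfD/=; congr (_ + _).
  by case: (z) => x y; case: (Q a b).
have ImAQ : A *m map_mx (@complex.Im K) Q =
    complex.Re z *: map_mx (@complex.Im K) Q
    + complex.Im z *: map_mx (@complex.Re K) Q + map_mx (@complex.Im K) Q'.
  apply/matrixP => a b; have :=
    congr1 (fun X : 'M[K[i]]_n => complex.Im (X a b)) AQ.
  rewrite !mxE raddf_sum/= => E.
  rewrite (_ : \sum_l _ = \sum_l complex.Im (complex_mx A a l * Q l b));
    last first.
    by apply: eq_bigr => l _; rewrite !mxE; case: (Q l b) => x y /=;
      rewrite mul0r addr0.
  rewrite E.
  rewrite raddfD/=; congr (_ + _).
  by case: (z) => x y; case: (Q a b) => x' y' /=; rewrite addrC.
have dRe t : is_derive t (1 : K)
    (fun t => (expmx (t *: A) *m map_mx (@complex.Re K) Q) i j)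
    (complex.Re z * (expmx (t *: A) *m map_mx (@complex.Re K) Q) i j
     - complex.Im z * (expmx (t *: A) *m map_mx (@complex.Im K) Q) i j
     + (expmx (t *: A) *m map_mx (@complex.Re K) Q') i j).
  apply: is_derive_eq (is_derive_expmxM _ _ _ _ _) _.
  by rewrite ReAQ mulmxDr mulmxBr -!scalemxAr !mxE.
have dIm t : is_derive t (1 : K)
    (fun t => (expmx (t *: A) *m map_mx (@complex.Im K) Q) i j)
    (complex.Re z * (expmx (t *: A) *m map_mx (@complex.Im K) Q) i j
     + complex.Im z * (expmx (t *: A) *m map_mx (@complex.Re K) Q) i j
     + (expmx (t *: A) *m map_mx (@complex.Im K) Q') i j).
  apply: is_derive_eq (is_derive_expmxM _ _ _ _ _) _.
  by rewrite ImAQ !mulmxDr -!scalemxAr !mxE.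
exact: (expdecay_ode z0 dRe dIm U V).
Qed.

(** The roots of the characteristic polynomial are eigenvalues, and by Cayley-Hamilton their factors
    annihilate every [Q], in particular the real matrix [B]. *)
Lemma Hurwitz_expdecay (K : realType) (n : nat) (A B : 'M[K]_n) i j :
  Hurwitz A -> expdecay (fun t => (expmx (t *: A) *m B) i j).
Proof.
case: n => [|n] in A B i j *; first by case: i.
move=> HA; have [r rE] := closed_field_poly_normal (char_poly (complex_mx A)).
have [||D _] := @expdecay_expmx_factors _ _ A r (complex_mx B) _ _ i j.
- move=> z zr; apply: HA; rewrite eigenvalue_root_char rE.
  by rewrite (monicP (char_poly_monic _)) scale1r root_prod_XsubC.
- have := Cayley_Hamilton (complex_mx A).
  rewrite rE (monicP (char_poly_monic _)) scale1r rmorph_prod/=.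
  under eq_bigr do rewrite rmorphB/= horner_mx_X horner_mx_C.
  by move=> ->; rewrite mul0mx.
by rewrite (_ : B = map_mx (@complex.Re K) (complex_mx B))//;
   apply/matrixP => a b; rewrite !mxE.
Qed.

(** * Integrals of decaying functions over the half-line *)

Lemma expdecay_cvg0 (K : realType) (f : K -> K) :
  expdecay f -> f t @[t --> +oo] --> 0.
Proof.
move=> [C [mu [C0 mu0 fC]]].
have e0 : C * expR (- (mu * t)) @[t --> +oo] --> 0.
  rewrite -(mulr0 C); apply: cvgMl_tmp.
  have muy : mu * t @[t --> +oo] --> +oo by exact: gt0_cvgMry.
  exact: (cvg_comp _ _ muy (@cvgr_expR K)).
have ne0 : - (C * expR (- (mu * t))) @[t --> +oo] --> 0.
  by rewrite -oppr0; exact: cvgN.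
apply: squeeze_cvgr ne0 e0; near=> t.
by rewrite -ler_norml fC.
Unshelve. all: by end_near. Qed.

(** Integrability provides the dominating function for decaying integrands; the value serves to
    remove the shift in [Rintegral_expdecay_derive]. *)
Lemma Rintegral_expRN (K : realType) (C mu : K) : 0 <= C -> 0 < mu ->
  (@lebesgue_measure K).-integrable `[0, +oo[
     (EFin \o (fun t => C * expR (- mu * t))) /\
  Rintegral (@lebesgue_measure K) `[0, +oo[ (fun t => C * expR (- mu * t))
    = C / mu.
Proof.
move=> C0 mu0.
have dF t : is_derive t (1 : K) ((- (C / mu)) \*: (fun t => expR (- mu * t)))
    (C * expR (- mu * t)).
  apply: is_derive_eq (is_deriveZ _ (is_derive_expRM (- mu) t)) _.
  by rewrite /GRing.scale/=; field; rewrite gt_eqF.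
have cf : continuous (fun t => C * expR (- mu * t)).
  by apply: (is_derive_continuous
    (fun t => is_deriveZ C (is_derive_expRM (- mu) t))).
have int :
  (\int[@lebesgue_measure K]_(x in `[0%R, +oo[) (C * expR (- mu * x))%:E
   = 0%:E - (((- (C / mu)) \*: (fun t => expR (- mu * t))) 0)%:E)%E.
  apply: ge0_continuous_FTC2y.
  - by move=> x _; rewrite mulr_ge0// expR_ge0.
  - exact: continuous_subspaceT.
  - apply: (@expdecay_cvg0 _ (fun t => _ *: _)).
    apply: expdecayZ; exists 1, mu; split => // t _.
    by rewrite ger0_norm ?expR_ge0// mul1r mulNr.
  - by move=> x _; case: (dF x).
  - by apply: cvg_at_right_filter; exact: (is_derive_continuous dF).
  - by move=> x _; rewrite derive1E; case: (dF x).
have val : 0 - ((- (C / mu)) \*: (fun t => expR (- mu * t)) : K -> K) 0 =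
  C / mu.
  by rewrite /= mulr0 expR0 /GRing.scale/= mulr1 sub0r opprK.
split; last by rewrite /Rintegral int -EFinB val.
apply/integrableP; split.
  apply/measurable_EFinP; apply: measurable_funTS.
  exact: continuous_measurable_fun.
under eq_integral do rewrite /= ger0_norm ?mulr_ge0 ?expR_ge0//.
by rewrite int -EFinB ltry.
Qed.

Lemma expdecay_integrable (K : realType) (f : K -> K) :
  continuous f -> expdecay f ->
  (@lebesgue_measure K).-integrable `[0, +oo[ (EFin \o f).
Proof.
move=> cf [C [mu [C0 mu0 fC]]].
apply: le_integrable (Rintegral_expRN C0 mu0).1 => //.
  apply/measurable_EFinP; apply: measurable_funTS.
  exact: continuous_measurable_fun.
move=> t /=; rewrite in_itv/= andbT => t0.
by rewrite lee_fin [leRHS]ger0_norm ?mulr_ge0 ?expR_ge0// mulNr fC.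
Qed.

(* The library has the fundamental theorem on a half-line for integrands of
   constant sign only, so [f] is first shifted by a multiple of [exp(- mu t)].
     *)
Lemma Rintegral_expdecay_derive (K : realType) (F f : K -> K) :
  (forall t, is_derive t (1 : K) F (f t)) -> continuous f ->
  expdecay F -> expdecay f ->
  Rintegral (@lebesgue_measure K) `[0, +oo[ f = - F 0.
Proof.
move=> dF cf decF decf; have [C [mu [C0 mu0 fC]]] := decf.
have [intE valE] := Rintegral_expRN C0 mu0.
have dG t : is_derive t (1 : K)
    (F + ((- (C / mu)) \*: (fun t => expR (- mu * t))))
    (f t + C * expR (- mu * t)).
  apply: is_derive_eq
    (is_deriveD (dF t) (is_deriveZ _ (is_derive_expRM (- mu) t))) _.
  by congr (_ + _); rewrite /GRing.scale/=; field; rewrite gt_eqF.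
have cE : continuous (fun t => C * expR (- mu * t)).
  by apply: (is_derive_continuous
    (fun t => is_deriveZ C (is_derive_expRM (- mu) t))).
have : Rintegral (@lebesgue_measure K)
  `[0, +oo[ (fun t => f t + C * expR (- mu * t))
   = 0 - (F + ((- (C / mu)) \*: (fun t => expR (- mu * t)))) 0.
  apply: Rintegral_ge0_continuous_FTC2y.
  - move=> x x0; have := fC x x0; rewrite ler_norml mulNr => /andP[+ _].
    by rewrite -subr_ge0 opprK.
  - apply: continuous_subspaceT => x.
    by apply: cvgD; [exact: cf | exact: cE].
  - apply: (@expdecay_cvg0 _ (fun t => _ t + _ *: _)).
    apply: expdecayD => //.
    apply: expdecayZ; exists 1, mu; split => // t _.
    by rewrite ger0_norm ?expR_ge0// mul1r mulNr.
  - by move=> x _; case: (dG x).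
  - by apply: cvg_at_right_filter; exact: (is_derive_continuous dG).
  - by move=> x _; rewrite derive1E; case: (dG x).
(* The integral [C / mu] of the shift cancels against the value at 0 of its antiderivative. *)
rewrite RintegralD//; last exact: expdecay_integrable.
rewrite valE [X in 0 - X]/= !fctE /= mulr0 expR0 /GRing.scale/= => E.
by apply: (@addIr _ (C / mu)); rewrite E; ring.
Qed.

(** * The Lyapunov equation for the integral operator *)

Definition lyap_integrand (K : realType) (n : nat) (A V : 'M[K]_n) (t : K) :
    'M[K]_n :=
  expmx (t *: A) *m V *m expmx (t *: A^T).

(** Both factors get the shape [expmx (t *: A) *m B], whose derivative and decay are known; hence
    the factor [1%:M]. *)
Lemma lyap_integrandE (K : realType) (n : nat) (A V : 'M[K]_n) i j :
  (fun t => lyap_integrand A V t i j) =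
  fun t => \sum_k (expmx (t *: A) *m V) i k * (expmx (t *: A) *m 1%:M) j k.
Proof.
apply/funext => t; rewrite /lyap_integrand expmx_tr mxE mulmx1.
by apply: eq_bigr => k _; rewrite !mxE.
Qed.

Lemma is_derive_lyap_integrand (K : realType) (n : nat) (A V : 'M[K]_n) (t : K)
    i j :
  is_derive t 1 (fun t => lyap_integrand A V t i j)
    ((A *m lyap_integrand A V t + lyap_integrand A V t *m A^T) i j).
Proof.
rewrite lyap_integrandE.
have := is_derive_sum (fun k => is_deriveM (is_derive_expmxM A V t i k)
  (is_derive_expmxM A 1%:M t j k)).
rewrite (_ : \sum_k _ = fun t => \sum_k (expmx (t *: A) *m V) i k *
    (expmx (t *: A) *m 1%:M) j k); last by apply/funext => x; rewrite fct_sumE.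
move=> d; apply: is_derive_eq d _.
(* The product rule puts [A] next to [V]; commutation with the exponential moves it outside. *)
have -> : A *m lyap_integrand A V t =
    expmx (t *: A) *m (A *m V) *m (expmx (t *: A))^T.
  by rewrite /lyap_integrand expmx_tr !mulmxA expmx_comm.
have -> : lyap_integrand A V t *m A^T =
    expmx (t *: A) *m V *m (expmx (t *: A) *m (A *m 1%:M))^T.
  by rewrite /lyap_integrand expmx_tr mulmx1 expmx_comm trmx_mul !mulmxA.
rewrite big_split/= addrC [RHS]mxE; congr (_ + _); rewrite [RHS]mxE.
  by apply: eq_bigr => k _; rewrite mulmx1 [RHS]mulrC; congr (_ * _);
    rewrite [RHS]mxE.
by apply: eq_bigr => k _; congr (_ * _); rewrite [RHS]mxE.
Qed.

Lemma continuous_lyap_integrand (K : realType) (n : nat) (A V : 'M[K]_n) i j :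
  continuous (fun t => lyap_integrand A V t i j).
Proof.
exact: is_derive_continuous (fun t => is_derive_lyap_integrand A V t i j).
Qed.

Lemma expdecay_lyap_integrand (K : realType) (n : nat) (A V : 'M[K]_n) i j :
  Hurwitz A -> expdecay (fun t => lyap_integrand A V t i j).
Proof.
move=> HA; rewrite lyap_integrandE; apply: expdecay_sum => k.
by apply: expdecayM; exact: Hurwitz_expdecay.
Qed.

Lemma integrable_lyap_integrand (K : realType) (n : nat) (A V : 'M[K]_n) i j :
  Hurwitz A ->
  (@lebesgue_measure K).-integrable `[0, +oo[
    (EFin \o (fun t => lyap_integrand A V t i j)).
Proof.
move=> HA; apply: expdecay_integrable; first exact: continuous_lyap_integrand.
exact: expdecay_lyap_integrand.
Qed.

(** Integrability is proved along with the value, since additivity at each step of the induction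
    requires it for the tail. *)
Lemma Rintegral_lincomb (K : realType) (I : Type) (r : seq I) (c : I -> K)
    (f : I -> K -> K) :
  (forall i, (@lebesgue_measure K).-integrable `[0, +oo[ (EFin \o f i)) ->
  (@lebesgue_measure K).-integrable `[0, +oo[
    (EFin \o (fun t => \sum_(i <- r) c i * f i t)) /\
  Rintegral (@lebesgue_measure K) `[0, +oo[ (fun t => \sum_(i <- r) c i * f i t)
  = \sum_(i <- r) c i * Rintegral (@lebesgue_measure K) `[0, +oo[ (f i).
Proof.
move=> intf; elim: r => [|i r [IHint IHval]].
  have -> : (fun t : K => \sum_(i <- [::]) c i * f i t) = cst 0.
    by apply/funext => t; rewrite big_nil.
  split; first exact: integrable0.
  by rewrite big_nil Rintegral_cst// mul0r.
have -> : (fun t : K => \sum_(i <- i :: r) c i * f i t) =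
    (fun t => c i * f i t + \sum_(i <- r) c i * f i t).
  by apply/funext => t; rewrite big_cons.
have intc : (@lebesgue_measure K).-integrable `[0, +oo[
    (EFin \o (fun t => c i * f i t)).
  rewrite (_ : EFin \o _ = (fun t => (c i)%:E * (EFin \o f i) t)%E).
    exact: integrableZl.
  by apply/funext => t; rewrite /= EFinM.
split.
  rewrite (_ : EFin \o _ = ((EFin \o (fun t => (c i * f i t)%R)) \+
     (EFin \o (fun t => (\sum_(i <- r) c i * f i t)%R)))%E);
       first exact: integrableD.
  by apply/funext => t; rewrite /= EFinD.
by rewrite RintegralD// RintegralZl// IHval big_cons.
Qed.

Lemma lyap_opP (K : realType) (n : nat) (A V : 'M[K]_n) :
  Hurwitz A -> A *m lyap_op A V + lyap_op A V *m A^T + V = 0.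
Proof.
move=> HA; apply/eqP; rewrite addr_eq0; apply/eqP/matrixP => i j.
have F0 : lyap_integrand A V 0 = V.
  by rewrite /lyap_integrand !expmx0 mul1mx mulmx1.
(* Indexing by a boolean and an index merges the two matrix products into one linear combination. *)
pose c (p : bool * 'I_n) := if p.1 then A i p.2 else A j p.2.
pose f (p : bool * 'I_n) t :=
  if p.1 then lyap_integrand A V t p.2 j else lyap_integrand A V t i p.2.
have fint p : (@lebesgue_measure K).-integrable `[0, +oo[ (EFin \o f p).
  by case: p => [[] k]; exact: integrable_lyap_integrand.
have sumE (g : bool * 'I_n -> K) :
    \sum_p g p = \sum_k g (true, k) + \sum_k g (false, k).
  rewrite -(big_bool _ (fun b => \sum_k g (b, k))) pair_bigA/=.
  by apply: eq_bigr => -[].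
have fE :
  (fun t => (A *m lyap_integrand A V t + lyap_integrand A V t *m A^T) i j)
    = fun t => \sum_p c p * f p t.
  apply/funext => t; rewrite sumE !mxE; congr (_ + _).
  by apply: eq_bigr => k _; rewrite mulrC mxE.
have decf p : expdecay (f p).
  by case: p => [[] k]; exact: expdecay_lyap_integrand.
have cf p : continuous (f p).
  by case: p => [[] k]; exact: continuous_lyap_integrand.
have := @Rintegral_expdecay_derive K (fun t => lyap_integrand A V t i j) _
  (fun t => is_derive_lyap_integrand A V t i j).
rewrite fE F0 (Rintegral_lincomb _ c fint).2 sumE => E.
rewrite [RHS]mxE -E.
- rewrite !mxE; congr (_ + _); apply: eq_bigr => k _; rewrite !mxE//.
  by rewrite mulrC.
- move=> t; apply: cvg_big => //; first exact: add_continuous.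
  by move=> p _; apply: cvgMl_tmp; exact: cf.
- exact: expdecay_lyap_integrand.
- by apply: expdecay_sum => p; exact: expdecayZ.
Qed.

(** Together with [lyap_opN], this transfers the symmetry type of [V] to the solution. *)
Lemma trmx_lyap_op (K : realType) (n : nat) (A V : 'M[K]_n) :
  (lyap_op A V)^T = lyap_op A V^T.
Proof.
apply/matrixP => i j; rewrite !mxE; apply: eq_Rintegral => t _.
rewrite expmx_tr.
transitivity ((expmx (t *: A) *m V *m (expmx (t *: A))^T)^T i j).
  by rewrite [RHS]mxE.
by rewrite !trmx_mul trmxK mulmxA.
Qed.

Lemma lyap_opN (K : realType) (n : nat) (A V : 'M[K]_n) :
  Hurwitz A -> lyap_op A (- V) = - lyap_op A V.
Proof.
move=> HA; apply/matrixP => i j; rewrite !mxE.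
rewrite -[RHS]mulN1r -RintegralZl//;
  last exact: (integrable_lyap_integrand V i j HA).
by apply: eq_Rintegral => t _; rewrite mulmxN mulNmx mxE mulN1r.
Qed.

(** * Noncommutative algebra of the cascade *)

Lemma resolvent_sandwich (F : comUnitRingType) (n : nat) (P N g w : 'M[F]_n) :
  P \in unitmx -> N \in unitmx -> g \in unitmx -> w = P *m g - g *m N ->
  invmx P *m w *m (- invmx N) =
  g *m (- invmx N) *m (invmx g *m w *m invmx g) *m invmx P *m g.
Proof.
move=> uP uN ug ->; transitivity (invmx P *m g *m 1%:M - g *m invmx N).
  rewrite mulmxBr mulmxA mulVmx// mul1mx mulmxN mulmxBl -!mulmxA.
  by rewrite mulmxV// mulmx1 opprB.
rewrite mulmxBr mulmxBl !mulmxA (mulmxK ug) (mulVmx ug) mul1mx.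
rewrite !mulmxBr !mulmxBl mulmx1 !mulmxN !mulNmx opprK addrC.
rewrite !mulmxA (mulmxKV uN) (mulmxV ug) mul1mx.
by rewrite -!mulmxA (mulKVmx uP) (mulVmx ug) mulmx1.
Qed.

(** Here [D] stands for [E~], [m] for [mho] and [c j] for the transpose of [alpha j]. Symmetry
    enters only through the two hypotheses with a minus sign, each use of which accounts for one
    factor [-1]. *)
Lemma cascade_pow (F : comPzRingType) (n : nat) (E D m : 'M[F]_n)
    (a b c g : nat -> 'M[F]_n) :
  a 1%N = g 0%N -> c 1%N = - a 1%N ->
  E *m m *m D = g 0%N *m D *m b 1%N *m E *m g 0%N ->
  (forall j, a j.+2 = g j.+1 *m b j.+1) ->
  (forall j, E *m (a j.+1 *m g j) *m D = g j.+1 *m D *m b j.+2 *m E *m g j.+1)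
    ->
  (forall j, b j.+1 *m g j.+1 = - c j.+2) ->
  forall k,
    (E *m m *m D) ^+ k.+1 =
    (-1) ^+ k.+1 *: ((\prod_(1 <= j < k.+2) (c j *m D)) *m b k.+1
       *m (\prod_(j <- rev (index_iota 1 k.+2)) (E *m a j))).
Proof.
move=> a1 c1 EmD aS EagD bg.
pose X k := \prod_(j <- rev (index_iota 1 k.+1)) (E *m a j).
have XS k : X k.+1 = E *m a k.+1 *m X k.
  rewrite /X (_ : index_iota 1 k.+2 = rcons (index_iota 1 k.+1) k.+1).
    by rewrite rev_rcons big_cons.
  by rewrite /index_iota !subn1 -cats1 -[k.+1 in LHS]addn1 iotaD.
have X0 : X 0%N = 1%:M by rewrite /X big_nil.
(* Passing [D] through the leftmost factor of the cascade by [EagD] leaves [g k.+1 *m b k.+1]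
   behind, which is the next [a]. *)
have XEmD k : X k *m (E *m m *m D) = g k *m D *m b k.+1 *m X k.+1.
  elim: k => [|k IH]; first by rewrite X0 mul1mx XS X0 mulmx1 a1 EmD !mulmxA.
  rewrite XS -mulmxA IH [X k.+2]XS aS !mulmxA.
  by rewrite -(mulmxA E) EagD.
elim=> [|k IH].
  rewrite expr1 big_nat1 -/(X 1%N) XS X0 mulmx1 expr1 scaleN1r c1.
  by rewrite !mulNmx opprK a1 EmD !mulmxA.
rewrite [in RHS]big_nat_recr//=
  exprSr IH -/(X k.+1) -/(X k.+2) -mulmxE -scalemxAl.
rewrite -(mulmxA _ (X k.+1)) XEmD !mulmxA -(mulmxA _ (b k.+1) (g k.+1)) bg.
rewrite !exprS !mulN1r !scaleNr.
by rewrite !mulmxN !mulNmx scalerN.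
Qed.

(** * Symmetry and Lyapunov identities of the system matrices *)

Lemma trmx_symplJ (K : realType) (h : nat) : (symplJ K h)^T = - symplJ K h.
Proof.
rewrite /symplJ tr_block_mx !trmx0 trmx1 linearN/= trmx1 opp_block_mx.
by rewrite !oppr0 opprK.
Qed.

Lemma trmx_mho_mx (K : realType) (n h : nat) (Theta : 'M[K]_n)
    (M : 'M[K]_(h + h, n)) :
  (mho_mx Theta M)^T = - mho_mx Theta M.
Proof. by rewrite /mho_mx !trmx_mul trmxK trmx_symplJ mulNmx mulmxN mulmxA. Qed.

(** The base case of the cascade: [gamma 0] is given as [Theta] and not as an integral, so its
    equation is checked algebraically. *)
Lemma lyapunov_drift (K : realType) (n h : nat) (Theta R : 'M[K]_n)
    (M : 'M[K]_(h + h, n)) :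
  Theta^T = - Theta -> R^T = R ->
  drift_mx Theta R M *m Theta + Theta *m (drift_mx Theta R M)^T
    + mho_mx Theta M = 0.
Proof.
move=> TT RT; rewrite /mho_mx /gain_mx /drift_mx.
have JT := trmx_symplJ K h.
set J := symplJ K h in JT *.
have trZ m p (a : K) (X : 'M[K]_(m, p)) : (a *: X)^T = a *: X^T.
  by apply/matrixP => i j; rewrite !mxE.
rewrite !trZ !trmx_mul [(R + _)^T]raddfD/= !trmx_mul !trmxK TT RT JT.
rewrite -!scalemxAl -!scalemxAr scalerA.
rewrite !mulmxDr !mulmxDl !mulmxDr !(mulmxN, mulNmx) !mulmxA.
(* The two terms in [X] cancel; those in [Y] add up to [4 Y], and [mho] equals [- 4 Y]. *)
set X := Theta *m R *m Theta; set Y := Theta *m M^T *m J *m M *m Theta.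
by apply/matrixP => i j; rewrite !mxE; ring.
Qed.

Lemma complex_mx_lyapunov (K : realType) (n : nat) (A g w : 'M[K]_n) (s : K[i])
  :
  A *m g + g *m A^T + w = 0 ->
  complex_mx w = (s%:M - complex_mx A) *m complex_mx g
    - complex_mx g *m (s%:M + complex_mx A^T).
Proof.
move=> /eqP; rewrite addrC addr_eq0 => /eqP ->.
rewrite /complex_mx map_mxN map_mxD !map_mxM mulmxBl mulmxDr.
by rewrite scalar_mxC !opprD addrACA subrr add0r.
Qed.

Lemma trmx_invmx_sign (K : fieldType) (n : nat) (b : bool) (g : 'M[K]_n) :
  g^T = (-1) ^+ b *: g -> (invmx g)^T = (-1) ^+ b *: invmx g.
Proof.
rewrite trmx_inv => ->; case: b; last by rewrite !scale1r.
have [ug|nug] := boolP (g \in unitmx); last first.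
  (* For singular [g] both inverses take the default value, namely their argument. *)
  rewrite /invmx (negbTE nug) ifF// unitmxE detZ unitrM.
  by rewrite -unitmxE (negbTE nug) andbF.
rewrite invmxZ ?invrN1//.
by rewrite unitmxE detZ unitrM -unitmxE ug andbT unitrX// unitrN1.
Qed.

Theorem theorem1 (K : realType) (n h : nat)
  (n_gt0 : (0 < n)%N) (n_even : ~~ odd n) (h_gt0 : (0 < h)%N)
  (Theta R : 'M[K]_n) (M : 'M[K]_(h + h, n))
  (Theta_unit : Theta \in unitmx) (Theta_anti : Theta^T = - Theta)
  (R_sym : R^T = R)
  (A_Hurwitz : Hurwitz (drift_mx Theta R M))
  (alpha beta gamma : nat -> 'M[K]_n)
  (alpha1 : alpha 1%N = Theta) (gamma0 : gamma 0%N = Theta)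
  (beta1 : beta 1%N = invmx Theta *m mho_mx Theta M *m invmx Theta)
  (alphaS : forall j : nat, (1 <= j)%N ->
     alpha j.+1 = gamma j *m beta j)
  (betaS : forall j : nat, (1 <= j)%N ->
     beta j.+1 =
       invmx (gamma j) *m alpha j *m gamma j.-1 *m invmx (gamma j))
  (gammaE : forall j : nat, (1 <= j)%N ->
     gamma j = lyap_op (drift_mx Theta R M) (alpha j *m gamma j.-1))
  (gamma_det : forall j : nat, (1 <= j)%N -> \det (gamma j) != 0) :
  let A := drift_mx Theta R M in
  let mho := complex_mx (mho_mx Theta M) in
  forall k : nat, (1 <= k)%N ->
  forall s : K[i],
    s%:M - complex_mx A \in unitmx ->
    s%:M + complex_mx A^T \in unitmx ->
    let E := tfE A s in
    let Eadj := tfEadj A s in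
    (E *m mho *m Eadj) ^+ k =
      (-1) ^+ k *:
        ((\prod_(1 <= j < k.+1) (complex_mx (alpha j)^T *m Eadj))
         *m complex_mx (beta k)
         *m (\prod_(j <- rev (index_iota 1 k.+1))
               (E *m complex_mx (alpha j)))).
Proof.
move=> A mho k k_gt0 s uP uN E Eadj; case: k k_gt0 => [//|k _].
have g_unit j : gamma j.+1 \in unitmx by rewrite unitmxE unitfE gamma_det.
(* Symmetry types alternate: [gamma 1] is symmetric, [beta 1] antisymmetric, and both types flip at
   each step. The three claims need a joint induction. *)
have sgn j : (alpha j.+1 *m gamma j)^T =
  (-1) ^+ odd j *: (alpha j.+1 *m gamma j)
    /\ (gamma j.+1)^T = (-1) ^+ odd j *: gamma j.+1
    /\ (beta j.+1)^T = (-1) ^+ (~~ odd j) *: beta j.+1.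
  have gsgn i : (alpha i.+1 *m gamma i)^T =
    (-1) ^+ odd i *: (alpha i.+1 *m gamma i) ->
      (gamma i.+1)^T = (-1) ^+ odd i *: gamma i.+1.
    move=> wT; rewrite (gammaE i.+1)//= trmx_lyap_op wT.
    case: (odd i); last by rewrite !scale1r.
    by rewrite !expr1 !scaleN1r lyap_opN.
  elim: j => [|j [wT [gT bT]]].
    have wT : (alpha 1%N *m gamma 0%N)^T =
      (-1) ^+ odd 0 *: (alpha 1%N *m gamma 0%N).
      by rewrite alpha1 gamma0 trmx_mul Theta_anti mulmxN mulNmx opprK scale1r.
    split=> //; split; first exact: gsgn.
    have iT : (invmx Theta)^T = - invmx Theta.
      by rewrite (@trmx_invmx_sign _ _ true) ?expr1 ?scaleN1r.
    rewrite beta1 trmx_mul (trmx_mul (invmx _)) trmx_mho_mx iT expr1 scaleN1r.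
    by rewrite !(mulmxN, mulNmx) opprK mulmxA.
  (* This product is [gamma beta gamma], in which the sign of [gamma] occurs twice, so it has the
     type of [beta j.+1]. *)
  have wT' : (alpha j.+2 *m gamma j.+1)^T =
      (-1) ^+ odd j.+1 *: (alpha j.+2 *m gamma j.+1).
    rewrite alphaS// !trmx_mul gT bT -!scalemxAl -!scalemxAr !scalerA mulmxA /=.
    by case: (odd j); rewrite ?expr0 ?expr1 ?mulN1r ?mul1r ?mulr1 ?opprK.
  split=> //; split; first exact: gsgn.
  (* Likewise [beta j.+2] has the type of [alpha j.+1 *m gamma j], which is opposite to that of
     [gamma j.+2]. *)
  rewrite betaS//= -(mulmxA _ (alpha _)) trmx_mul (trmx_mul (invmx _)).
  rewrite wT (trmx_invmx_sign gT) negbK.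
  rewrite -!scalemxAl -!scalemxAr !scalerA !mulmxA.
  by case: (odd j); rewrite ?(expr0, expr1, mulN1r, mul1r, opprK).
have complexM (X Y : 'M[K]_n) : complex_mx (X *m Y) =
  complex_mx X *m complex_mx Y.
  exact: map_mxM.
have complexV (X : 'M[K]_n) : complex_mx (invmx X) = invmx (complex_mx X).
  exact: map_invmx.
have complexN (X : 'M[K]_n) : complex_mx (- X) = - complex_mx X.
  exact: map_mxN.
have complexU (X : 'M[K]_n) : X \in unitmx -> complex_mx X \in unitmx.
  by rewrite map_unitmx.
apply: (@cascade_pow _ _ E Eadj mho (fun j => complex_mx (alpha j))
  (fun j => complex_mx (beta j)) (fun j => complex_mx (alpha j)^T)
  (fun j => complex_mx (gamma j))).
- by rewrite alpha1 gamma0.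
- by rewrite alpha1 Theta_anti complexN.
- rewrite gamma0 beta1 !complexM !complexV.
  apply: resolvent_sandwich; rewrite ?complexU//.
  exact: complex_mx_lyapunov (lyapunov_drift _ _ _).
- by move=> j; rewrite alphaS// complexM.
- move=> j; rewrite betaS//=
    !complexM !complexV -(mulmxA _ (complex_mx (alpha _))).
  apply: resolvent_sandwich; rewrite ?complexU//.
  rewrite -complexM; apply: complex_mx_lyapunov.
  by rewrite (gammaE j.+1)//; exact: lyap_opP.
- move=> j; have [_ [gT bT]] := sgn j.
  rewrite alphaS// -complexN -complexM trmx_mul gT bT.
  rewrite -!scalemxAl -!scalemxAr !scalerA.
  by case: (odd j); rewrite ?expr0 ?expr1 ?mulN1r ?mul1r ?mulr1 scaleN1r opprK.
Qed.
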